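(* Let $R>0$, $\kappa>0$ and $B>0$ be constants. The closed form solution of the stationary state limit ($\partial_tJ^t=0$) of the New IDSA system is given by $$\begin{array}{rclr} J^t(r)&=&B\left(1-\frac Rr\,\frac{\sinh(\sqrt3\kappa r)}{\sinh(\sqrt3\kappa R)}\right),& r<R,\\[6pt] J^s(r)&=&C\,\frac{3\kappa^2BR}{\sinh(\sqrt3\kappa R)}\left(\frac{\sinh(\sqrt3\kappa r)}{(\sqrt3\kappa r)^2}-\frac{\cosh(\sqrt3\kappa r)}{\sqrt3\kappa r}\right),& r<R,\\[6pt] J^t(r)&=&0,& r\ge R,\\[6pt] J^s(r)&=&\frac B2\left[1+\frac{e^{-2\kappa R}-1}{2\kappa R}\right]\left(1-\sqrt{1-\left(\frac Rr\right)^2}\right),& r\ge R, \end{array}$$ where $$C=\frac R2\left[1+\frac{e^{-2\kappa R}-1}{2\kappa R}\right]\left(1-\frac{\sqrt3\kappa R}{\tanh(\sqrt3\kappa R)}\right)^{-1}.$$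
   Context: The New IDSA system for the trapped component $J^t(t,r)$ and streaming component $J^s(t,r)$ is $$\begin{array}{rclr} \partial_tJ^t-\frac1{r^2}\partial_r\left(\frac{r^2}{3\kappa}\partial_rJ^t\right)&=&\kappa(B-J^t),& r<R,\\[4pt] J^s&=&C\,\partial_rJ^t=\frac B2\left[1+\frac{e^{-2\kappa R}-1}{2\kappa R}\right]\frac{\partial_rJ^t}{\partial_rJ^t|_{r=R}},& r<R,\\[4pt] J^t&=&0,& r\ge R,\\[4pt] \frac1{r^2}\partial_r\left(r^2g(r)J^s\right)&=&0,& r\ge R, \end{array}$$ with $g(r)=\frac12\left(1+\sqrt{1-(R/r)^2}\right)$. Here $\partial_rJ^t|_{r=R}$ is the one-sided derivative from $r<R$, and the constant $C$ is chosen so that $J^s(R)=\frac B2\left[1+\frac{e^{-2\kappa R}-1}{2\kappa R}\right]$. Boundary conditions: $J^t$ is continuous at $r=R$ (so $J^t\to0$ as $r\to R^-$), $\partial_rJ^t\to0$ as $r\to0^+$ (homogeneous Neumann condition), and $J^s(R)=\frac B2\left[1+\frac{e^{-2\kappa R}-1}{2\kappa R}\right]$. Values at $r=0$ are understood by continuous extension. *)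

(* Defs.v *)
From Stdlib Require Import Reals.
From Coquelicot Require Import Coquelicot.
Open Scope R_scope.

(* Fields are total functions of (t, r); only t > 0 and r >= 0 are meaningful.
   [Rad] is the radius of the ball. *)

Definition is_derive_left (f : R -> R) (x l : R) : Prop :=
  filterlim (fun y => (f y - f x) / (y - x)) (at_left x) (locally l).

Definition is_derive_right (f : R -> R) (x l : R) : Prop :=
  filterlim (fun y => (f y - f x) / (y - x)) (at_right x) (locally l).

Definition geom_factor (Rad r : R) : R :=
  1 / 2 * (1 + sqrt (1 - (Rad / r) ^ 2)).

Definition surface_Js (Rad kappa B : R) : R :=
  B / 2 * (1 + (exp (- 2 * kappa * Rad) - 1) / (2 * kappa * Rad)).

(* Instantaneous form, at time [t], of the New IDSA system in the classical
   sense.  The factor [C] is constant in r, but in the time-dependent system it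
   depends on t through the normalisation by the surface derivative. *)
Record new_idsa_at (Rad kappa B : R) (Jt Js : R -> R -> R) (C t : R) : Prop :=
{ idsa_diff_t : forall r, 0 < r < Rad -> ex_derive (fun s => Jt s r) t;
  idsa_diff_r : forall r, 0 < r < Rad -> ex_derive (Jt t) r;
  idsa_diff_flux : forall r, 0 < r < Rad ->
    ex_derive (fun s => s ^ 2 / (3 * kappa) * Derive (Jt t) s) r;
  idsa_trapped_in : forall r, 0 < r < Rad ->
    Derive (fun s => Jt s r) t
    - 1 / r ^ 2 * Derive (fun s => s ^ 2 / (3 * kappa) * Derive (Jt t) s) r
    = kappa * (B - Jt t r);
  idsa_streaming_in : exists d : R,
    is_derive_left (Jt t) Rad d /\ d <> 0 /\
    C * d = surface_Js Rad kappa B /\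
    forall r, 0 < r < Rad ->
      Js t r = C * Derive (Jt t) r /\
      C * Derive (Jt t) r = surface_Js Rad kappa B * (Derive (Jt t) r / d);
  idsa_trapped_out : forall r, Rad <= r -> Jt t r = 0;
  idsa_streaming_out : forall r, Rad < r ->
    ex_derive (fun s => s ^ 2 * geom_factor Rad s * Js t s) r /\
    1 / r ^ 2 * Derive (fun s => s ^ 2 * geom_factor Rad s * Js t s) r = 0;
  (* At r = Rad the exterior equation only involves r >= Rad. *)
  idsa_streaming_surface : exists l : R,
    is_derive_right (fun s => s ^ 2 * geom_factor Rad s * Js t s) Rad l /\
    1 / Rad ^ 2 * l = 0;
  idsa_bc_cont : continuous (Jt t) Rad;
  idsa_bc_neumann : filterlim (Derive (Jt t)) (at_right 0) (locally 0);
  idsa_bc_surface : Js t Rad = surface_Js Rad kappa B;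
  idsa_ext0_Jt : filterlim (Jt t) (at_right 0) (locally (Jt t 0));
  idsa_ext0_Js : filterlim (Js t) (at_right 0) (locally (Js t 0)) }.

Definition new_idsa (Rad kappa B : R) (Jt Js : R -> R -> R) (C : R -> R) : Prop :=
  forall t, 0 < t -> new_idsa_at Rad kappa B Jt Js (C t) t.

Definition stationary (Rad : R) (Jt : R -> R -> R) : Prop :=
  forall t r, 0 < t -> 0 < r < Rad -> is_derive (fun s => Jt s r) t 0.

(* [f] is given on [0, Rad) by an expression [g] that is singular at 0. *)
Definition given_inside (Rad : R) (f g : R -> R) : Prop :=
  (forall r, 0 < r < Rad -> f r = g r) /\ Finite (f 0) = Lim g 0.

(* Main.v *)
(* For a stationary state, [w = r (Jt - B)] satisfies [w'' = a^2 w] on (0, Rad) with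
   [a = sqrt 3 * kappa]. Boundedness of [Jt] at 0 leaves only the multiples of
   [sinh (a r)], and [Jt = 0] at [Rad] fixes the multiple; the Neumann condition is then
   automatic. The surface slope is nonzero since [tanh x < x] for [x > 0], which
   determines [C]. Outside, [r^2 g Js] is constant, with value [Rad^2 / 2] times the
   surface value of [Js], and [g (1 - sqrt (1 - (Rad / r)^2)) = (Rad / r)^2 / 2]. *)

Require Import Defs.
From Stdlib Require Import Reals Lra.
From Coquelicot Require Import Coquelicot.
Open Scope R_scope.

(** * One-sided limits, and the value at the centre *)

Lemma ex_derive_at_right (f : R -> R) (x : R) :
  ex_derive f x -> filterlim f (at_right x) (locally (f x)).
Proof.
  intros Hex P HP; assert (Hf := ex_derive_continuous f x Hex).
  exact (filter_imp _ (fun y => x < y -> P (f y)) (fun y Hy _ => Hy) (Hf P HP)).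
Qed.

Lemma continuous_at_left (f : R -> R) (x : R) :
  continuous f x -> filterlim f (at_left x) (locally (f x)).
Proof.
  intros Hf P HP.
  exact (filter_imp _ (fun y => y < x -> P (f y)) (fun y Hy _ => Hy) (Hf P HP)).
Qed.

Lemma at_right_interval (x b : R) (P : R -> Prop) :
  x < b -> (forall y, x < y < b -> P y) -> at_right x P.
Proof.
  intros Hb HP; unfold at_right, within.
  apply (filter_imp (fun y => y < b)).
  - intros y Hy Hxy; apply HP; lra.
  - exact (open_lt b x Hb).
Qed.

Lemma at_left_interval (x a : R) (P : R -> Prop) :
  a < x -> (forall y, a < y < x -> P y) -> at_left x P.
Proof.
  intros Ha HP; unfold at_left, within.
  apply (filter_imp (fun y => a < y)).
  - intros y Hy Hxy; apply HP; lra.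
  - exact (open_gt a x Ha).
Qed.

Lemma locally_interval (a b x : R) (P : R -> Prop) :
  a < x < b -> (forall y, a < y < b -> P y) -> locally x P.
Proof.
  intros Hx HP; apply (filter_imp (fun y => a < y /\ y < b)).
  - intros y Hy; apply HP; lra.
  - apply filter_and; [exact (open_gt a x (proj1 Hx)) | exact (open_lt b x (proj2 Hx))].
Qed.

Lemma filterlim_Rmult (F : (R -> Prop) -> Prop) (FF : Filter F) (f g : R -> R) (lf lg : R) :
  filterlim f F (locally lf) -> filterlim g F (locally lg) ->
  filterlim (fun x => f x * g x) F (locally (lf * lg)).
Proof.
  intros Hf Hg.
  exact (filterlim_comp_2 f g Rmult Hf Hg (filterlim_mult (K := R_AbsRing) lf lg)).
Qed.

(** At a finite point [Lim] is the limit along the single sequence [x + / (INR n + 1)], which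
    approaches [x] strictly from the right. A right limit therefore determines it, whatever happens
    at [x] or to its left. *)
Lemma Lim_of_at_right (f : R -> R) (x l : R) :
  filterlim f (at_right x) (locally l) -> Lim f x = l.
Proof.
  intros Hf; unfold Lim; apply is_lim_seq_unique.
  apply (filterlim_comp _ _ _ (Rbar_loc_seq x) f eventually (at_right x)); [|exact Hf].
  intros P HP; unfold filtermap.
  assert (Hl : is_lim_seq (Rbar_loc_seq x) x).
  { apply is_lim_seq_spec. intros eps.
    (* With [N] the integer part of [/ eps], every [n >= N] has [/ eps < INR n + 1]. *)
    destruct (nfloor_ex (/ eps)) as [N [_ HN]].
    { apply Rlt_le, Rinv_0_lt_compat, cond_pos. }
    exists N; intros n Hn; simpl.
    replace (x + / (INR n + 1) - x) with (/ (INR n + 1)) by ring.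
    assert (He := cond_pos eps).
    assert (INR N <= INR n) by (apply le_INR; exact Hn).
    assert (0 < / eps) by (apply Rinv_0_lt_compat; exact He).
    rewrite Rabs_pos_eq; [|apply Rlt_le, Rinv_0_lt_compat; lra].
    rewrite <- (Rinv_inv eps); apply Rinv_lt_contravar; [|lra].
    apply Rmult_lt_0_compat; lra. }
  specialize (Hl _ HP); unfold filtermap in Hl.
  revert Hl; apply filter_imp; intros n Hn; apply Hn; simpl.
  assert (0 < / (INR n + 1)); [|lra].
  apply Rinv_0_lt_compat; generalize (pos_INR n); lra.
Qed.

Lemma given_inside_ext (Rad : R) (f g h : R -> R) :
  (forall r, g r = h r) -> given_inside Rad f g <-> given_inside Rad f h.
Proof.
  intros Hgh; unfold given_inside.
  rewrite (Lim_ext g h) by (intros; apply Hgh).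
  split; intros [H1 H2]; split; try exact H2; intros r Hr; rewrite (H1 r Hr); auto.
Qed.

Lemma given_inside_intro (Rad : R) (f g : R -> R) :
  0 < Rad -> (forall r, 0 < r < Rad -> f r = g r) ->
  filterlim f (at_right 0) (locally (f 0)) -> given_inside Rad f g.
Proof.
  intros HR Hfg Hf; split; [exact Hfg|].
  symmetry; apply Lim_of_at_right.
  apply (filterlim_ext_loc f); [|exact Hf].
  exact (at_right_interval 0 Rad _ HR Hfg).
Qed.

(** [given_inside] only prescribes [f 0] as a value of [Lim], which is a total function. A genuine
    right limit of [g] is what turns this into continuity of [f] at the centre. *)
Lemma given_inside_at_right (Rad : R) (f g : R -> R) (l : R) :
  0 < Rad -> given_inside Rad f g -> filterlim g (at_right 0) (locally l) ->
  filterlim f (at_right 0) (locally (f 0)).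
Proof.
  intros HR [Hfg H0] Hg.
  rewrite (Lim_of_at_right _ _ _ Hg) in H0; injection H0 as ->.
  apply (filterlim_ext_loc g); [|exact Hg].
  apply (at_right_interval 0 Rad _ HR); intros y Hy; symmetry; exact (Hfg y Hy).
Qed.

(** * Hyperbolic inequalities *)

Lemma sinh_pos (x : R) : 0 < x -> 0 < sinh x.
Proof. intros Hx; rewrite <- sinh_0; apply sinh_lt; exact Hx. Qed.

Lemma cosh_gt_1 (x : R) : 0 < x -> 1 < cosh x.
Proof.
  intros Hx; rewrite <- cosh_0.
  destruct (MVT_cor2 cosh sinh 0 x Hx) as [c [Hc Hcx]].
  { intros; apply derivable_pt_lim_cosh. }
  assert (0 < sinh c) by (apply sinh_pos; lra); nra.
Qed.

Lemma sinh_gt_id (x : R) : 0 < x -> x < sinh x.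
Proof.
  intros Hx.
  destruct (MVT_cor2 sinh cosh 0 x Hx) as [c [Hc Hcx]].
  { intros; apply derivable_pt_lim_sinh. }
  rewrite sinh_0 in Hc.
  assert (1 < cosh c) by (apply cosh_gt_1; lra); nra.
Qed.

(** The function [y * cosh y - sinh y] vanishes at 0 and has derivative [y * sinh y], which is
    positive and increasing, so the mean value theorem gives both bounds. The lower one is
    [tanh x < x]; the upper one controls the slope near the centre. *)
Lemma mul_cosh_sub_sinh_bounds (x : R) :
  0 < x -> 0 < x * cosh x - sinh x < x ^ 2 * sinh x.
Proof.
  intros Hx.
  destruct (MVT_cor2 (fun y => y * cosh y - sinh y) (fun y => y * sinh y) 0 x Hx)
    as [c [Hc Hcx]].
  { intros c _; apply is_derive_Reals; auto_derive; [easy|].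
    ring. }
  rewrite sinh_0 in Hc.
  assert (0 < sinh c) by (apply sinh_pos; lra).
  assert (sinh c < sinh x) by (apply sinh_lt; lra).
  assert (0 < c * sinh c) by nra.
  assert (c * sinh c < x * sinh x) by nra.
  nra.
Qed.

(** * The closed form inside the ball *)

Definition ball_profile (a Rad B r : R) : R :=
  B * (1 - Rad / r * (sinh (a * r) / sinh (a * Rad))).

(** The radial derivative of [ball_profile], arranged like the claimed [Js / C] with [a ^ 2] in
    place of [3 * kappa ^ 2]. *)
Definition ball_slope (a Rad B r : R) : R :=
  a ^ 2 * B * Rad / sinh (a * Rad)
  * (sinh (a * r) / (a * r) ^ 2 - cosh (a * r) / (a * r)).

Section Ball.

Variables a Rad B : R.
Hypotheses (ha : 0 < a) (hR : 0 < Rad).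

Let sinh_Rad : sinh (a * Rad) <> 0.
Proof. apply Rgt_not_eq, sinh_pos; nra. Qed.

Lemma is_derive_ball_profile (r : R) :
  r <> 0 -> is_derive (ball_profile a Rad B) r (ball_slope a Rad B r).
Proof.
  intros Hr; unfold ball_profile, ball_slope; auto_derive; [auto|].
  field; repeat split; auto; lra.
Qed.

Lemma is_derive_ball_flux (kappa r : R) :
  kappa <> 0 -> a ^ 2 = 3 * kappa ^ 2 -> r <> 0 ->
  is_derive (fun s => s ^ 2 / (3 * kappa) * ball_slope a Rad B s) r
    (r ^ 2 * kappa * (ball_profile a Rad B r - B)).
Proof.
  intros Hk Ha Hr; unfold ball_profile, ball_slope; auto_derive.
  { rewrite Rmult_1_r; auto using Rmult_integral_contrapositive_currified, Rgt_not_eq. }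
  (* The right side is rearranged to display [3 * kappa ^ 2], so that it can be exchanged for
     [a ^ 2]; what remains is a rational identity. *)
  replace (r ^ 2 * kappa * (B * (1 - Rad / r * (sinh (a * r) / sinh (a * Rad))) - B))
    with (- (3 * kappa ^ 2) * (r * B * Rad * sinh (a * r) / sinh (a * Rad)) / (3 * kappa))
    by (field; repeat split; auto).
  rewrite <- Ha; field; repeat split; auto; lra.
Qed.

Lemma ball_profile_surface : ball_profile a Rad B Rad = 0.
Proof. unfold ball_profile; field; split; auto; lra. Qed.

Lemma ball_slope_surface :
  ball_slope a Rad B Rad = B / Rad * (1 - a * Rad / tanh (a * Rad)).
Proof.
  unfold ball_slope, tanh; field; repeat split; auto; try lra.
  apply Rgt_not_eq; assert (1 < cosh (a * Rad)) by (apply cosh_gt_1; nra); lra.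
Qed.

(** This is [tanh x < x] at [x = a * Rad]. It makes the surface slope nonzero, so that dividing by
    it to obtain [C] is legitimate. *)
Lemma surface_factor_neg : 1 - a * Rad / tanh (a * Rad) < 0.
Proof.
  assert (Hx : 0 < a * Rad) by nra.
  assert (Hc := cosh_gt_1 _ Hx); assert (Hs := sinh_pos _ Hx).
  destruct (mul_cosh_sub_sinh_bounds _ Hx) as [H _].
  unfold tanh.
  replace (1 - a * Rad / (sinh (a * Rad) / cosh (a * Rad)))
    with (- ((a * Rad * cosh (a * Rad) - sinh (a * Rad)) / sinh (a * Rad)))
    by (field; split; lra).
  apply Ropp_lt_gt_0_contravar, Rdiv_lt_0_compat; assumption.
Qed.

Lemma ball_profile_center :
  filterlim (ball_profile a Rad B) (at_right 0)
    (locally (B * (1 - a * Rad / sinh (a * Rad)))).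
Proof.
  assert (Hq : filterlim (fun r => sinh (a * r) / (a * r)) (at_right 0) (locally 1)).
  (* Squeeze [1 <= sinh x / x <= cosh x] for [x = a * r > 0]. *)
  { apply (filterlim_le_le (fun _ => 1) _ (fun r => cosh (a * r)) 1).
    - apply (at_right_interval 0 1); [lra|]; intros r Hr.
      assert (Hx : 0 < a * r) by nra.
      assert (Hs := sinh_gt_id _ Hx); destruct (mul_cosh_sub_sinh_bounds _ Hx) as [H _].
      split; apply (Rmult_le_reg_r (a * r)); auto; unfold Rdiv;
        rewrite ?Rmult_assoc, ?Rinv_l; lra.
    - apply filterlim_const.
    - simpl; replace 1 with (cosh (a * 0)) by (rewrite Rmult_0_r; apply cosh_0).
      apply (ex_derive_at_right (fun r => cosh (a * r))); auto_derive; easy. }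
  apply (filterlim_ext_loc
    (fun r => B * (1 - a * Rad / sinh (a * Rad) * (sinh (a * r) / (a * r))))).
  { apply (at_right_interval 0 1); [lra|]; intros r Hr.
    unfold ball_profile; field; repeat split; auto; lra. }
  replace (B * (1 - a * Rad / sinh (a * Rad)))
    with (B * (1 - a * Rad / sinh (a * Rad) * 1)) by ring.
  apply (filterlim_comp _ _ _ (fun r => sinh (a * r) / (a * r))
    (fun q => B * (1 - a * Rad / sinh (a * Rad) * q)) _ _ _ Hq).
  apply (ex_derive_continuous (fun q => B * (1 - a * Rad / sinh (a * Rad) * q)));
    auto_derive; easy.
Qed.

Lemma ball_slope_center : filterlim (ball_slope a Rad B) (at_right 0) (locally 0).
Proof.
  replace 0 with (a ^ 2 * B * Rad / sinh (a * Rad) * 0) at 2 by ring.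
  apply filterlim_Rmult; [apply at_right_proper_filter|apply filterlim_const|].
  assert (H0 : forall c, filterlim (fun r => c * sinh (a * r)) (at_right 0) (locally 0)).
  { intros c; replace 0 with (c * sinh (a * 0)) at 2
      by (rewrite Rmult_0_r, sinh_0; ring).
    apply (ex_derive_at_right (fun r => c * sinh (a * r))); auto_derive; easy. }
  (* The bracket equals [- (x * cosh x - sinh x) / x ^ 2] with [x = a * r], hence lies between
     [- sinh x] and 0. Both bounds are written as multiples of [sinh (a * r)] so that [H0] covers
     them. *)
  apply (filterlim_le_le (fun r => -1 * sinh (a * r)) _ (fun r => 0 * sinh (a * r)) 0);
    [|apply H0|apply H0].
  apply (at_right_interval 0 1); [lra|]; intros r Hr.
  assert (Hx : 0 < a * r) by nra.
  assert (Hx2 : 0 < (a * r) ^ 2) by (apply pow_lt; exact Hx).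
  destruct (mul_cosh_sub_sinh_bounds _ Hx) as [H1 H2].
  replace (sinh (a * r) / (a * r) ^ 2 - cosh (a * r) / (a * r))
    with (- (a * r * cosh (a * r) - sinh (a * r)) / (a * r) ^ 2)
    by (field; split; lra).
  split; apply (Rmult_le_reg_r ((a * r) ^ 2)); auto; unfold Rdiv;
    rewrite ?(Rmult_assoc _ (/ _)), ?Rinv_l; lra.
Qed.

End Ball.

(** * One-sided derivatives *)

Lemma is_derive_left_of_is_derive (f g : R -> R) (b x l : R) :
  b < x -> (forall y, b < y <= x -> f y = g y) -> is_derive g x l ->
  is_derive_left f x l.
Proof.
  intros Hb Hfg Hg; unfold is_derive_left.
  apply (filterlim_ext_loc (fun y => (g y - g x) / (y - x))).
  (* The left difference quotient sees only points of [(b, x]]. The slope at the surface can thus be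
     read off from a formula smooth across [x], although [f] may differ from it beyond [x]. *)
  { apply (at_left_interval x b _ Hb); intros y Hy; rewrite !Hfg; lra. }
  apply is_derive_Reals in Hg.
  intros P [eps HP]; destruct (Hg eps (cond_pos eps)) as [delta Hd].
  unfold filtermap, at_left, within; exists delta; intros y Hy Hyx; apply HP.
  specialize (Hd (y - x)); replace (x + (y - x)) with y in Hd by (cbn in *; ring).
  apply Hd; [lra|exact Hy].
Qed.

Lemma is_derive_right_continuous (f : R -> R) (x l : R) :
  is_derive_right f x l -> filterlim f (at_right x) (locally (f x)).
Proof.
  intros Hf.
  apply (filterlim_ext_loc (fun y => (f y - f x) / (y - x) * (y - x) + f x)).
  { apply (at_right_interval x (x + 1)); [lra|]; intros y Hy; field; lra. }
  assert (Hm : filterlim (fun y => (f y - f x) / (y - x) * (y - x)) (at_right x)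
                 (locally (l * (x - x)))).
  { apply filterlim_Rmult; [apply at_right_proper_filter|exact Hf|].
    apply (ex_derive_at_right (fun y => y - x)); auto_derive; easy. }
  replace (locally (f x)) with (locally (l * (x - x) + f x)) by (f_equal; ring).
  apply (filterlim_comp _ _ _ _ (fun z => z + f x) _ _ _ Hm).
  apply (ex_derive_continuous (fun z => z + f x)); auto_derive; easy.
Qed.

(** * Uniqueness for the radial equation *)

Lemma constant_on_open (f : R -> R) (a b : R) :
  (forall x, a < x < b -> is_derive f x 0) ->
  forall x y, a < x < b -> a < y < b -> f x = f y.
Proof.
  intros Hf.
  assert (H : forall x y, a < x < b -> a < y < b -> x < y -> f x = f y).
  { intros x y Hx Hy Hxy; apply (eq_is_derive f x y); [|exact Hxy].
    intros t Ht; apply Hf; lra. }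
  intros x y Hx Hy; destruct (Rtotal_order x y) as [Hxy|[->|Hxy]]; auto.
  symmetry; auto.
Qed.

(* [w'' = a^2 w] splits into [p' = a p] for [p = w' + a w] and [q' = - a q] for
   [q = w' - a w]. *)
Lemma hyperbolic_ode_solution (a b : R) (w v : R -> R) :
  a <> 0 -> 0 < b ->
  (forall r, 0 < r < b -> is_derive w r (v r)) ->
  (forall r, 0 < r < b -> is_derive v r (a ^ 2 * w r)) ->
  exists p q, forall r, 0 < r < b -> w r = p * exp (a * r) + q * exp (- (a * r)).
Proof.
  intros Ha Hb Hw Hv.
  (* Integrating factors: each first-order factor times the matching exponential has zero
     derivative. *)
  assert (Hp := constant_on_open (fun r => (v r + a * w r) * exp (- (a * r))) 0 b).
  assert (Hq := constant_on_open (fun r => (v r - a * w r) * exp (a * r)) 0 b).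
  assert (Hex : forall r, 0 < r < b -> ex_derive v r /\ ex_derive w r).
  { intros r Hr; split; eexists; [apply Hv|apply Hw]; exact Hr. }
  assert (HD : forall r, 0 < r < b -> Derive v r = a ^ 2 * w r /\ Derive w r = v r).
  { intros r Hr; split; apply is_derive_unique; auto. }
  assert (Hp' : forall r, 0 < r < b ->
    is_derive (fun r => (v r + a * w r) * exp (- (a * r))) r 0).
  { intros r Hr; destruct (Hex r Hr); destruct (HD r Hr) as [E1 E2].
    auto_derive; [auto|].
    change (Derive (fun x => v x) r) with (Derive v r).
    change (Derive (fun x => w x) r) with (Derive w r).
    rewrite E1, E2; ring. }
  assert (Hq' : forall r, 0 < r < b ->
    is_derive (fun r => (v r - a * w r) * exp (a * r)) r 0).
  { intros r Hr; destruct (Hex r Hr); destruct (HD r Hr) as [E1 E2].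
    auto_derive; [auto|].
    change (Derive (fun x => v x) r) with (Derive v r).
    change (Derive (fun x => w x) r) with (Derive w r).
    rewrite E1, E2; ring. }
  (* The two constants are evaluated at an arbitrary reference point, here the midpoint. The
     coefficients come from [2 * a * w = (v + a * w) - (v - a * w)]. *)
  set (m := b / 2); assert (Hm : 0 < m < b) by (unfold m; lra).
  exists ((v m + a * w m) * exp (- (a * m)) / (2 * a)),
         (- ((v m - a * w m) * exp (a * m)) / (2 * a)).
  intros r Hr.
  specialize (Hp Hp' m r Hm Hr); specialize (Hq Hq' m r Hm Hr); cbv beta in Hp, Hq.
  rewrite Hp, Hq.
  assert (E : exp (a * r) * exp (- (a * r)) = 1)
    by (rewrite <- exp_plus, Rplus_opp_r; apply exp_0).
  transitivity ((2 * a * w r) * (exp (a * r) * exp (- (a * r))) / (2 * a));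
    [rewrite E|]; field; exact Ha.
Qed.

(* In terms of [w = r (u - B)] the radial equation becomes [w'' = a^2 w]. *)
Lemma radial_boundary_problem (kappa a Rad B L : R) (u : R -> R) :
  0 < kappa -> 0 < a -> a ^ 2 = 3 * kappa ^ 2 -> 0 < Rad ->
  (forall r, 0 < r < Rad -> ex_derive u r) ->
  (forall r, 0 < r < Rad ->
     is_derive (fun s => s ^ 2 / (3 * kappa) * Derive u s) r
       (r ^ 2 * kappa * (u r - B))) ->
  filterlim u (at_right 0) (locally L) ->
  filterlim u (at_left Rad) (locally 0) ->
  forall r, 0 < r < Rad -> u r = ball_profile a Rad B r.
Proof.
  intros Hk Ha Hak HR Hu Hflux H0 HRad.
  set (w := fun r => r * (u r - B)).
  set (v := fun r => u r - B + r * Derive u r).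
  assert (Hw : forall r, 0 < r < Rad -> is_derive w r (v r)).
  { intros r Hr; unfold w, v; auto_derive; [auto|].
    change (Derive (fun x => u x) r) with (Derive u r); ring. }
  assert (Hu' : forall r, 0 < r < Rad ->
    is_derive (Derive u) r (a ^ 2 * (u r - B) - 2 / r * Derive u r)).
  { intros r Hr.
    (* Only the flux is assumed differentiable, so [Derive u] is recovered near [r] as
       [3 * kappa / s ^ 2] times the flux. *)
    apply (is_derive_ext_loc
      (fun s => 3 * kappa / s ^ 2 * (s ^ 2 / (3 * kappa) * Derive u s))).
    { apply (locally_interval 0 Rad _ _ Hr); intros y Hy.
      change (3 * kappa / y ^ 2 * (y ^ 2 / (3 * kappa) * Derive u y) = Derive u y).
      field; lra. }
    assert (Hf := Hflux r Hr).
    set (F := fun s => s ^ 2 / (3 * kappa) * Derive u s) in *.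
    assert (HF : ex_derive F r) by (eexists; exact Hf).
    assert (EF : Derive F r = r ^ 2 * kappa * (u r - B)) by (apply is_derive_unique; exact Hf).
    assert (Er : F r = r ^ 2 / (3 * kappa) * Derive u r) by reflexivity.
    change (is_derive (fun s => 3 * kappa / s ^ 2 * F s) r
      (a ^ 2 * (u r - B) - 2 / r * Derive u r)).
    (* With its body hidden, the flux is differentiated as an atom by [auto_derive], and its
       derivative is supplied by [EF]. *)
    clearbody F.
    auto_derive; [split; [nra|auto]|].
    change (Derive (fun x => F x) r) with (Derive F r).
    rewrite EF, Er, Hak; field; lra. }
  assert (Hv : forall r, 0 < r < Rad -> is_derive v r (a ^ 2 * w r)).
  { intros r Hr; unfold v.
    assert (HD := Hu' r Hr).
    assert (Hu1 := Hu r Hr).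
    assert (ED := is_derive_unique _ _ _ HD).
    assert (Hex : ex_derive (Derive u) r) by (eexists; exact HD).
    set (du := Derive u) in *.
    assert (Eu : Derive u r = du r) by reflexivity.
    clearbody du.
    auto_derive; [auto|].
    change (Derive (fun x => u x) r) with (Derive u r).
    change (Derive (fun x => du x) r) with (Derive du r).
    rewrite ED, Eu; unfold w; field; lra. }
  destruct (hyperbolic_ode_solution a Rad w v) as [p [q Hpq]]; auto; [lra|].
  (* Since [u] has a finite limit at the centre, [w = r * (u - B)] tends to 0 there, while the
     exponential form tends to [p + q]. *)
  assert (Epq : p + q = 0).
  { apply (filterlim_locally_unique (K := R_AbsRing) (V := R_NormedModule)
      (F := at_right 0) w).
    - apply (filterlim_ext_loc (fun r => p * exp (a * r) + q * exp (- (a * r)))).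
      { apply (at_right_interval 0 Rad _ HR); intros y Hy; symmetry; exact (Hpq y Hy). }
      replace (p + q) with (p * exp (a * 0) + q * exp (- (a * 0)))
        by (rewrite Rmult_0_r, Ropp_0, exp_0; ring).
      apply (ex_derive_at_right (fun r => p * exp (a * r) + q * exp (- (a * r)))).
      auto_derive; easy.
    - cut (filterlim w (at_right 0) (locally (0 * (L - B)))); [rewrite Rmult_0_l; easy|].
      unfold w; apply filterlim_Rmult; [apply at_right_proper_filter| |].
      + apply (ex_derive_at_right (fun r => r)), ex_derive_id.
      + apply (filterlim_comp _ _ _ u (fun z => z - B) _ _ _ H0).
        apply (ex_derive_continuous (fun z => z - B)); auto_derive; easy. }
  assert (Hsol : forall r, 0 < r < Rad -> u r = B + 2 * p * sinh (a * r) / r).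
  { intros r Hr; assert (E := Hpq r Hr); unfold w in E.
    replace q with (- p) in E by lra.
    replace (u r) with (B + r * (u r - B) / r) by (field; lra).
    rewrite E; unfold sinh; field; lra. }
  assert (Hs : sinh (a * Rad) <> 0) by (apply Rgt_not_eq, sinh_pos; nra).
  (* The surface condition: the left limit of the solved form at [Rad] must be the prescribed 0,
     which fixes [p]. *)
  assert (Ep : B + 2 * p * sinh (a * Rad) / Rad = 0).
  { apply (filterlim_locally_unique (K := R_AbsRing) (V := R_NormedModule)
      (F := at_left Rad) u); [|exact HRad].
    apply (filterlim_ext_loc (fun r => B + 2 * p * sinh (a * r) / r)).
    { apply (at_left_interval Rad 0 _ HR); intros y Hy; symmetry; exact (Hsol y Hy). }
    apply (continuous_at_left (fun r => B + 2 * p * sinh (a * r) / r)),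
      (ex_derive_continuous (V := R_NormedModule)).
    auto_derive; lra. }
  intros r Hr; rewrite (Hsol r Hr); unfold ball_profile.
  replace p with (- (B * Rad) / (2 * sinh (a * Rad))).
  - field; split; [exact Hs|lra].
  - apply (Rmult_eq_reg_r (2 * sinh (a * Rad) / Rad)).
    + replace (- (B * Rad) / (2 * sinh (a * Rad)) * (2 * sinh (a * Rad) / Rad))
        with (- B) by (field; split; [lra|exact Hs]).
      unfold Rdiv in *; lra.
    + apply Rmult_integral_contrapositive_currified; [lra|].
      apply Rinv_neq_0_compat; lra.
Qed.

(** * The exterior streaming flux *)

Lemma constant_from_right (f : R -> R) (x : R) :
  filterlim f (at_right x) (locally (f x)) -> (forall y, x < y -> is_derive f y 0) ->
  forall y, x <= y -> f y = f x.
Proof.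
  intros Hx Hf y [Hy|<-]; [|reflexivity].
  apply (filterlim_locally_unique (K := R_AbsRing) (V := R_NormedModule)
    (F := at_right x) f); [|exact Hx].
  (* On [(x, y)] the function already equals [f y], so its right limit at [x] is both [f y] and
     [f x]. *)
  apply (filterlim_ext_loc (fun _ => f y)); [|apply filterlim_const].
  apply (at_right_interval x y _ Hy); intros z Hz.
  apply (constant_on_open f x (y + 1)); try lra.
  intros s Hs; apply Hf; lra.
Qed.

Lemma geom_factor_pos (Rad r : R) : 0 < geom_factor Rad r.
Proof. unfold geom_factor; generalize (sqrt_pos (1 - (Rad / r) ^ 2)); lra. Qed.

(** A difference of squares. The condition [Rad <= r] keeps the radicand nonnegative, so [sqrt]
    squares back to it. *)
Lemma geom_factor_mul_conj (Rad r : R) :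
  0 < Rad -> Rad <= r ->
  geom_factor Rad r * (1 - sqrt (1 - (Rad / r) ^ 2)) = (Rad / r) ^ 2 / 2.
Proof.
  intros HR Hr; unfold geom_factor.
  assert (Hq : 0 < Rad / r <= 1).
  { split; [apply Rdiv_lt_0_compat; lra|].
    apply (Rmult_le_reg_r r); [lra|]; unfold Rdiv; rewrite Rmult_assoc, Rinv_l; lra. }
  assert (E : sqrt (1 - (Rad / r) ^ 2) * sqrt (1 - (Rad / r) ^ 2) = 1 - (Rad / r) ^ 2)
    by (apply sqrt_sqrt; nra).
  lra.
Qed.

Lemma exterior_flux_iff (Rad S r j : R) :
  0 < Rad -> Rad <= r ->
  r ^ 2 * geom_factor Rad r * j = Rad ^ 2 / 2 * S <->
  j = S * (1 - sqrt (1 - (Rad / r) ^ 2)).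
Proof.
  intros HR Hr.
  assert (Hg := geom_factor_pos Rad r).
  assert (E : r ^ 2 * geom_factor Rad r * (S * (1 - sqrt (1 - (Rad / r) ^ 2)))
    = Rad ^ 2 / 2 * S).
  { replace (r ^ 2 * geom_factor Rad r * (S * (1 - sqrt (1 - (Rad / r) ^ 2))))
      with (r ^ 2 * S * (geom_factor Rad r * (1 - sqrt (1 - (Rad / r) ^ 2)))) by ring.
    rewrite geom_factor_mul_conj by assumption; field; lra. }
  split; [intros H; rewrite <- E in H|intros H; rewrite H; exact E].
  apply Rmult_eq_reg_l in H; [exact H|].
  apply Rmult_integral_contrapositive_currified; [apply pow_nonzero|]; lra.
Qed.

(** * The stationary state: necessity and sufficiency at a fixed time *)

Section StationaryState.

Variables (Rad kappa B : R).
Hypotheses (hR : 0 < Rad) (hkappa : 0 < kappa) (hB : 0 < B).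

Let a := sqrt 3 * kappa.

Let a_pos : 0 < a.
Proof. apply Rmult_lt_0_compat; [apply sqrt_lt_R0; lra|exact hkappa]. Qed.

Let a_sq : a ^ 2 = 3 * kappa ^ 2.
Proof. unfold a; rewrite Rpow_mult_distr, pow2_sqrt; lra. Qed.

Definition surface_constant : R :=
  Rad / 2 * (1 + (exp (- 2 * kappa * Rad) - 1) / (2 * kappa * Rad))
  * / (1 - a * Rad / tanh (a * Rad)).

Lemma ball_slope_surface_neg : ball_slope a Rad B Rad < 0.
Proof.
  rewrite ball_slope_surface by assumption.
  assert (H := surface_factor_neg a Rad a_pos hR).
  assert (0 < B / Rad) by (apply Rdiv_lt_0_compat; assumption); nra.
Qed.

Lemma surface_constant_spec (c : R) :
  c * ball_slope a Rad B Rad = surface_Js Rad kappa B <-> c = surface_constant.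
Proof.
  assert (Hneg := ball_slope_surface_neg).
  assert (Hf := surface_factor_neg a Rad a_pos hR).
  assert (E : surface_constant * ball_slope a Rad B Rad = surface_Js Rad kappa B).
  { rewrite ball_slope_surface by assumption; unfold surface_constant, surface_Js.
    set (f := 1 - a * Rad / tanh (a * Rad)) in *; field; lra. }
  split; [intros H; rewrite <- E in H|intros H; rewrite H; exact E].
  apply Rmult_eq_reg_r in H; [exact H|lra].
Qed.

(** Time enters only through the vanishing derivative of [Jt] at [t], so each instant reduces to a
    boundary value problem in [r]. *)
Lemma stationary_state_unique (Jt Js : R -> R -> R) (C t : R) :
  new_idsa_at Rad kappa B Jt Js C t ->
  (forall r, 0 < r < Rad -> is_derive (fun s => Jt s r) t 0) ->
  C = surface_constant /\
  given_inside Rad (Jt t) (ball_profile a Rad B) /\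
  given_inside Rad (Js t) (fun r => C * ball_slope a Rad B r) /\
  (forall r, Rad <= r ->
     Js t r = surface_Js Rad kappa B * (1 - sqrt (1 - (Rad / r) ^ 2))).
Proof.
  intros H Hst.
  assert (HJRad : Jt t Rad = 0) by (apply (idsa_trapped_out _ _ _ _ _ _ _ H); lra).
  assert (HJ : forall r, 0 < r < Rad -> Jt t r = ball_profile a Rad B r).
  { apply (radial_boundary_problem kappa a Rad B (Jt t 0)); auto.
    - apply (idsa_diff_r _ _ _ _ _ _ _ H).
    - intros r Hr.
      assert (E := idsa_trapped_in _ _ _ _ _ _ _ H r Hr).
      assert (Et : Derive (fun s => Jt s r) t = 0) by exact (is_derive_unique _ _ _ (Hst r Hr)).
      rewrite Et in E.
      replace (r ^ 2 * kappa * (Jt t r - B))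
        with (Derive (fun s => s ^ 2 / (3 * kappa) * Derive (Jt t) s) r).
      + apply Derive_correct, (idsa_diff_flux _ _ _ _ _ _ _ H r Hr).
      + set (D := Derive _ r) in *.
        replace D with (- r ^ 2 * (0 - 1 / r ^ 2 * D)) by (field; lra).
        rewrite E; ring.
    - apply (idsa_ext0_Jt _ _ _ _ _ _ _ H).
    - rewrite <- HJRad; apply continuous_at_left, (idsa_bc_cont _ _ _ _ _ _ _ H). }
  assert (HD : forall r, 0 < r < Rad -> Derive (Jt t) r = ball_slope a Rad B r).
  { intros r Hr; apply is_derive_unique, (is_derive_ext_loc (ball_profile a Rad B)).
    - apply (locally_interval 0 Rad _ _ Hr); intros y Hy; symmetry; exact (HJ y Hy).
    - apply is_derive_ball_profile; auto; lra. }
  destruct (idsa_streaming_in _ _ _ _ _ _ _ H) as [d [Hd [_ [HCd HJs]]]].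
  (* Left limits are unique, and [Jt t] agrees with [ball_profile] up to and including [Rad], where
     both vanish. *)
  assert (Ed : d = ball_slope a Rad B Rad).
  { apply (filterlim_locally_unique (K := R_AbsRing) (V := R_NormedModule) _ _ _ Hd).
    apply (is_derive_left_of_is_derive _ (ball_profile a Rad B) 0); [exact hR| |].
    - intros y [Hy0 [Hy| ->]]; [apply HJ; auto|].
      rewrite HJRad, ball_profile_surface; auto.
    - apply is_derive_ball_profile; auto; lra. }
  rewrite Ed in HCd.
  split; [|split; [|split]].
  - apply surface_constant_spec; exact HCd.
  - apply given_inside_intro; auto; apply (idsa_ext0_Jt _ _ _ _ _ _ _ H).
  - apply given_inside_intro; auto; [|apply (idsa_ext0_Js _ _ _ _ _ _ _ H)].
    intros r Hr; rewrite (proj1 (HJs r Hr)), HD; auto.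
  - intros r Hr; apply exterior_flux_iff; auto.
    rewrite (constant_from_right (fun s => s ^ 2 * geom_factor Rad s * Js t s) Rad);
      auto.
    (* At [r = Rad] the root vanishes and the geometric factor is 1/2, whence the flux constant
       [Rad ^ 2 / 2] times the surface value. *)
    + rewrite (idsa_bc_surface _ _ _ _ _ _ _ H); unfold geom_factor.
      replace (1 - (Rad / Rad) ^ 2) with 0 by (field; lra).
      rewrite sqrt_0; field.
    + destruct (idsa_streaming_surface _ _ _ _ _ _ _ H) as [l [Hl _]].
      exact (is_derive_right_continuous _ _ _ Hl).
    + intros y Hy; destruct (idsa_streaming_out _ _ _ _ _ _ _ H y Hy) as [Hex E].
      replace 0 with (Derive (fun s => s ^ 2 * geom_factor Rad s * Js t s) y).
      * apply Derive_correct; exact Hex.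
      * set (D := Derive _ y) in *.
        replace D with (y ^ 2 * (1 / y ^ 2 * D)) by (field; lra).
        rewrite E; ring.
Qed.

Lemma stationary_state_solves (Jt Js : R -> R -> R) (C t : R) :
  (forall r, 0 < r < Rad -> is_derive (fun s => Jt s r) t 0) ->
  C = surface_constant ->
  given_inside Rad (Jt t) (ball_profile a Rad B) ->
  given_inside Rad (Js t) (fun r => C * ball_slope a Rad B r) ->
  (forall r, Rad <= r -> Jt t r = 0) ->
  (forall r, Rad <= r ->
     Js t r = surface_Js Rad kappa B * (1 - sqrt (1 - (Rad / r) ^ 2))) ->
  new_idsa_at Rad kappa B Jt Js C t.
Proof.
  intros Hst HC HJt HJs HJout HJsout.
  assert (HJ : forall r, 0 < r <= Rad -> Jt t r = ball_profile a Rad B r).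
  { intros r [Hr [Hr'| ->]]; [apply (proj1 HJt); auto|].
    rewrite HJout, ball_profile_surface; auto; lra. }
  assert (Hd : forall r, 0 < r < Rad -> is_derive (Jt t) r (ball_slope a Rad B r)).
  { intros r Hr; apply (is_derive_ext_loc (ball_profile a Rad B)).
    - apply (locally_interval 0 Rad _ _ Hr); intros y Hy; symmetry; apply HJ; lra.
    - apply is_derive_ball_profile; auto; lra. }
  assert (HD : forall r, 0 < r < Rad -> Derive (Jt t) r = ball_slope a Rad B r).
  { intros r Hr; apply is_derive_unique; auto. }
  assert (Hflux : forall r, 0 < r < Rad ->
    is_derive (fun s => s ^ 2 / (3 * kappa) * Derive (Jt t) s) r
      (r ^ 2 * kappa * (Jt t r - B))).
  { intros r Hr; rewrite HJ by lra.
    apply (is_derive_ext_loc (fun s => s ^ 2 / (3 * kappa) * ball_slope a Rad B s)).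
    - apply (locally_interval 0 Rad _ _ Hr); intros y Hy; rewrite HD; auto.
    - apply is_derive_ball_flux; auto; lra. }
  assert (Hneg := ball_slope_surface_neg).
  assert (HCd := proj2 (surface_constant_spec C) HC).
  assert (Hext : forall r, Rad <= r ->
    r ^ 2 * geom_factor Rad r * Js t r = Rad ^ 2 / 2 * surface_Js Rad kappa B).
  { intros r Hr; apply exterior_flux_iff; auto. }
  constructor.
  - intros r Hr; eexists; apply Hst; exact Hr.
  - intros r Hr; eexists; apply Hd; exact Hr.
  - intros r Hr; eexists; apply Hflux; exact Hr.
  - intros r Hr.
    assert (Et : Derive (fun s => Jt s r) t = 0) by exact (is_derive_unique _ _ _ (Hst r Hr)).
    assert (Er : Derive (fun s => s ^ 2 / (3 * kappa) * Derive (Jt t) s) r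
      = r ^ 2 * kappa * (Jt t r - B)) by exact (is_derive_unique _ _ _ (Hflux r Hr)).
    rewrite Et, Er.
    field; lra.
  - exists (ball_slope a Rad B Rad); split; [|split; [lra|split; [exact HCd|]]].
    + apply (is_derive_left_of_is_derive _ (ball_profile a Rad B) 0); auto.
      apply is_derive_ball_profile; auto; lra.
    + intros r Hr; rewrite <- HCd; split.
      * rewrite HD by exact Hr; apply (proj1 HJs); exact Hr.
      * field; lra.
  - exact HJout.
  - intros r Hr.
    assert (Hr0 : is_derive (fun s => s ^ 2 * geom_factor Rad s * Js t s) r 0).
    { apply (is_derive_ext_loc (fun _ => Rad ^ 2 / 2 * surface_Js Rad kappa B)).
      - apply (locally_interval Rad (r + 1)); [lra|].
        intros y Hy; symmetry; apply Hext; lra.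
      - exact (is_derive_const _ _). }
    split; [eexists; exact Hr0|].
    assert (E0 : Derive (fun s => s ^ 2 * geom_factor Rad s * Js t s) r = 0)
      by exact (is_derive_unique _ _ _ Hr0).
    rewrite E0; ring.
  - exists 0; split; [|ring].
    unfold is_derive_right; apply (filterlim_ext_loc (fun _ => 0)); [|apply filterlim_const].
    apply (at_right_interval Rad (Rad + 1)); [lra|]; intros y Hy.
    rewrite !Hext by lra; field; lra.
  - assert (HRad : Jt t Rad = ball_profile a Rad B Rad) by (apply HJ; lra).
    assert (Hc : continuous (ball_profile a Rad B) Rad).
    { apply (ex_derive_continuous (ball_profile a Rad B)); eexists.
      apply is_derive_ball_profile; auto; lra. }
    (* Continuity at the surface is compared with [ball_profile], which is smooth across [Rad]: up
       to [Rad] the two coincide, and beyond it [Jt] equals its surface value 0 exactly. *)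
    apply filterlim_locally; intros eps.
    assert (Hloc := proj1 (filterlim_locally _ _) Hc eps).
    apply (filter_imp (fun y => 0 < y /\ ball (ball_profile a Rad B Rad) eps
      (ball_profile a Rad B y))); [|apply filter_and; [exact (open_gt 0 Rad hR)|exact Hloc]].
    intros y [Hy0 Hy]; rewrite HRad.
    destruct (Rle_lt_dec y Rad); [rewrite HJ by lra; exact Hy|].
    rewrite HJout, ball_profile_surface by (auto; lra); apply ball_center.
  - apply (filterlim_ext_loc (ball_slope a Rad B)); [|apply ball_slope_center; auto].
    apply (at_right_interval 0 Rad _ hR); intros y Hy; symmetry; auto.
  - rewrite HJsout by lra.
    replace (1 - (Rad / Rad) ^ 2) with 0 by (field; lra); rewrite sqrt_0; ring.
  - exact (given_inside_at_right _ _ _ _ hR HJt (ball_profile_center a Rad B a_pos hR)).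
  - apply (given_inside_at_right _ _ _ (C * 0) hR HJs).
    apply filterlim_Rmult; [apply at_right_proper_filter|apply filterlim_const|].
    apply ball_slope_center; auto.
Qed.

End StationaryState.

Theorem proposition6 (Rad kappa B : R)
  (hR : 0 < Rad) (hkappa : 0 < kappa) (hB : 0 < B)
  (Jt Js : R -> R -> R) (C : R -> R) :
  (new_idsa Rad kappa B Jt Js C /\ stationary Rad Jt) <->
  (forall t, 0 < t ->
     C t = Rad / 2 * (1 + (exp (- 2 * kappa * Rad) - 1) / (2 * kappa * Rad))
           * / (1 - sqrt 3 * kappa * Rad / tanh (sqrt 3 * kappa * Rad)) /\
     given_inside Rad (Jt t) (fun r =>
       B * (1 - Rad / r * (sinh (sqrt 3 * kappa * r) / sinh (sqrt 3 * kappa * Rad)))) /\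
     given_inside Rad (Js t) (fun r =>
       C t * (3 * kappa ^ 2 * B * Rad / sinh (sqrt 3 * kappa * Rad))
       * (sinh (sqrt 3 * kappa * r) / (sqrt 3 * kappa * r) ^ 2
          - cosh (sqrt 3 * kappa * r) / (sqrt 3 * kappa * r))) /\
     (forall r, Rad <= r -> Jt t r = 0) /\
     (forall r, Rad <= r ->
        Js t r = B / 2 * (1 + (exp (- 2 * kappa * Rad) - 1) / (2 * kappa * Rad))
                 * (1 - sqrt (1 - (Rad / r) ^ 2)))).
Proof.
  (* The stated form of [Js] has the coefficient [3 * kappa ^ 2], that of [ball_slope] has
     [(sqrt 3 * kappa) ^ 2]. *)
  assert (Hslope : forall t r,
    C t * (3 * kappa ^ 2 * B * Rad / sinh (sqrt 3 * kappa * Rad))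
    * (sinh (sqrt 3 * kappa * r) / (sqrt 3 * kappa * r) ^ 2
       - cosh (sqrt 3 * kappa * r) / (sqrt 3 * kappa * r))
    = C t * ball_slope (sqrt 3 * kappa) Rad B r).
  { intros t r; unfold ball_slope.
    rewrite (Rpow_mult_distr (sqrt 3) kappa 2), (pow2_sqrt 3) by lra; ring. }
  split.
  - intros [Hsys Hst] t Ht.
    destruct (stationary_state_unique Rad kappa B hR hkappa hB Jt Js (C t) t
      (Hsys t Ht) (fun r Hr => Hst t r Ht Hr)) as [HC [HJt [HJs Hout]]].
    split; [exact HC|split; [exact HJt|split; [|split; [|exact Hout]]]].
    + refine (proj2 (given_inside_ext _ _ _ _ (Hslope t)) HJs).
    + apply (idsa_trapped_out _ _ _ _ _ _ _ (Hsys t Ht)).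
  - intros H.
    (* The closed form holds at every positive time with a right side free of [t], so [Jt] is
       constant in time on a neighbourhood of [t]. *)
    assert (Hst : stationary Rad Jt).
    { intros t r Ht Hr.
      apply (is_derive_ext_loc (fun _ => ball_profile (sqrt 3 * kappa) Rad B r)).
      - apply (locally_interval 0 (t + 1)); [lra|]; intros s Hs.
        destruct (H s (proj1 Hs)) as [_ [HJt _]]; symmetry; exact (proj1 HJt r Hr).
      - exact (is_derive_const _ _). }
    split; [|exact Hst]; intros t Ht.
    destruct (H t Ht) as [HC [HJt [HJs [HJout Hout]]]].
    apply stationary_state_solves; auto.
    exact (proj1 (given_inside_ext _ _ _ _ (Hslope t)) HJs).
Qed.
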